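(* The translation $(-)^\#$ of $\mathsf{MS4}$ into $\mathsf{MS4.t}$ is full and faithful; that is, for every formula $\varphi$ of $\mathcal L_{\Box\forall}$, $$\mathsf{MS4}\vdash\varphi\quad\text{iff}\quad\mathsf{MS4.t}\vdash\varphi^\# .$$
   Context: For a unary modality $\blacksquare$, the $\mathsf{S4}$-axioms are $\blacksquare(p\to q)\to(\blacksquare p\to\blacksquare q)$, $\blacksquare p\to p$, $\blacksquare p\to\blacksquare\blacksquare p$; the $\mathsf{S5}$-axioms for $\forall$ are the $\mathsf{S4}$-axioms for $\forall$ together with $p\to\forall\exists p$, where $\exists:=\neg\forall\neg$. **MS4.** $\mathcal L_{\Box\forall}$ is the classical propositional language with unary modalities $\Box,\forall$. $\mathsf{MS4}$ is the least set of $\mathcal L_{\Box\forall}$-formulas containing all classical tautologies, the $\mathsf{S4}$-axioms for $\Box$, the $\mathsf{S5}$-axioms for $\forall$, the axiom $\Box\forall p\to\forall\Box p$, and closed under modus ponens, substitution, and necessitation for $\Box$ and $\forall$. **MS4.t.** $\mathcal L_{T\forall}$ is the classical propositional language with unary modalities $\Box_F,\Box_P,\forall$; $\Diamond_F:=\neg\Box_F\neg$, $\Diamond_P:=\neg\Box_P\neg$, $\exists:=\neg\forall\neg$. $\mathsf{MS4.t}$ is the least set of $\mathcal L_{T\forall}$-formulas containing all classical tautologies, the $\mathsf{S4}$-axioms for $\Box_F$ and for $\Box_P$, the tense axioms $p\to\Box_P\Diamond_F p$ and $p\to\Box_F\Diamond_P p$, the $\mathsf{S5}$-axioms for $\forall$,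 the axiom $\Box_F\forall p\to\forall\Box_F p$, and closed under modus ponens, substitution, and necessitation for $\Box_F,\Box_P,\forall$. **Translation.** For an $\mathcal L_{\Box\forall}$-formula $\varphi$, $\varphi^\#$ is the $\mathcal L_{T\forall}$-formula obtained by replacing every occurrence of $\Box$ in $\varphi$ with $\Box_F$. *)

(* Defs.v *)
(* Classical propositional formulas over countably many variables, with one
   unary modality for each element of [M]. *)
Inductive form (M : Type) : Type :=
| Var (n : nat)
| Bot
| Neg (A : form M)
| And (A B : form M)
| Or (A B : form M)
| Imp (A B : form M)
| Box (m : M) (A : form M).

Arguments Var {M} n.
Arguments Bot {M}.
Arguments Neg {M} A.
Arguments And {M} A B.
Arguments Or {M} A B.
Arguments Imp {M} A B.
Arguments Box {M} m A.

Definition Dia {M : Type} (m : M) (A : form M) : form M :=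
  Neg (Box m (Neg A)).

Declare Scope form_scope.
Delimit Scope form_scope with form.
Bind Scope form_scope with form.
Notation "A ~> B" := (Imp A B) (at level 60, right associativity) : form_scope.
Open Scope form_scope.

Fixpoint subst {M : Type} (s : nat -> form M) (A : form M) : form M :=
  match A with
  | Var n => s n
  | Bot => Bot
  | Neg B => Neg (subst s B)
  | And B C => And (subst s B) (subst s C)
  | Or B C => Or (subst s B) (subst s C)
  | Imp B C => Imp (subst s B) (subst s C)
  | Box m B => Box m (subst s B)
  end.

(* Two-valued truth: [v] values the variables, and [w] values the formulas
   [Box m B], which are treated as further propositional atoms. *)
Fixpoint truth {M : Type} (v : nat -> bool) (w : M -> form M -> bool)
    (A : form M) : bool :=
  match A with
  | Var n => v n
  | Bot => false
  | Neg B => negb (truth v w B)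
  | And B C => andb (truth v w B) (truth v w C)
  | Or B C => orb (truth v w B) (truth v w C)
  | Imp B C => implb (truth v w B) (truth v w C)
  | Box m B => w m B
  end.

Definition tautology {M : Type} (A : form M) : Prop :=
  forall v w, truth v w A = true.

(* The least set of formulas that contains the tautologies and [Ax] and is
   closed under modus ponens, uniform substitution, and necessitation for every
   modality of the language. *)
Inductive logic {M : Type} (Ax : form M -> Prop) : form M -> Prop :=
| logic_taut A : tautology A -> logic Ax A
| logic_ax A : Ax A -> logic Ax A
| logic_mp A B : logic Ax (A ~> B) -> logic Ax A -> logic Ax B
| logic_subst s A : logic Ax A -> logic Ax (subst s A)
| logic_nec m A : logic Ax A -> logic Ax (Box m A).

Section Modal.

Context {M : Type}.

Let p : form M := Var 0.
Let q : form M := Var 1.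

Inductive S4_axiom (m : M) : form M -> Prop :=
| S4_K : S4_axiom m (Box m (p ~> q) ~> (Box m p ~> Box m q))
| S4_T : S4_axiom m (Box m p ~> p)
| S4_4 : S4_axiom m (Box m p ~> Box m (Box m p)).

Inductive S5_axiom (m : M) : form M -> Prop :=
| S5_S4 A : S4_axiom m A -> S5_axiom m A
| S5_B : S5_axiom m (p ~> Box m (Dia m p)).

Inductive tense_axiom (f b : M) : form M -> Prop :=
| tense_bf : tense_axiom f b (p ~> Box b (Dia f p))
| tense_fb : tense_axiom f b (p ~> Box f (Dia b p)).

Inductive mix_axiom (b a : M) : form M -> Prop :=
| mix : mix_axiom b a (Box b (Box a p) ~> Box a (Box b p)).

End Modal.

Inductive modality_MS4 : Type := Nec | All.

Inductive modality_MS4t : Type := Fut | Past | AllT.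

Inductive MS4_axiom : form modality_MS4 -> Prop :=
| MS4_Nec A : S4_axiom Nec A -> MS4_axiom A
| MS4_All A : S5_axiom All A -> MS4_axiom A
| MS4_mix A : mix_axiom Nec All A -> MS4_axiom A.

Inductive MS4t_axiom : form modality_MS4t -> Prop :=
| MS4t_Fut A : S4_axiom Fut A -> MS4t_axiom A
| MS4t_Past A : S4_axiom Past A -> MS4t_axiom A
| MS4t_tense A : tense_axiom Fut Past A -> MS4t_axiom A
| MS4t_All A : S5_axiom AllT A -> MS4t_axiom A
| MS4t_mix A : mix_axiom Fut AllT A -> MS4t_axiom A.

Definition MS4 : form modality_MS4 -> Prop := logic MS4_axiom.

Definition MS4t : form modality_MS4t -> Prop := logic MS4t_axiom.

Fixpoint sharp (A : form modality_MS4) : form modality_MS4t :=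
  match A with
  | Var n => Var n
  | Bot => Bot
  | Neg B => Neg (sharp B)
  | And B C => And (sharp B) (sharp C)
  | Or B C => Or (sharp B) (sharp C)
  | Imp B C => Imp (sharp B) (sharp C)
  | Box Nec B => Box Fut (sharp B)
  | Box All B => Box AllT (sharp B)
  end.

(* Main.v *)
Require Import Defs.
From Stdlib Require Import Cantor Lia ClassicalEpsilon.

(** From left to right, [sharp] maps tautologies to tautologies, axioms of
    [MS4] to axioms of [MS4t], and commutes with substitution and with the
    modalities, so a derivation in [MS4] translates step by step.

    From right to left, the argument is semantic.  The canonical frame of [MS4]
    consists of its maximal consistent theories, with [x R y] when [Box Nec A]
    in [x] implies [A] in [y], and [x E y] when [Box All A] in [x] implies [A]
    in [y].  All axioms are canonical: [R] is a preorder, [E] is an equivalence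
    relation, and [x E y R z] implies [x R u E z] for some [u]
    ([canonical_mix]).  Interpreting the past modality by the converse of [R]
    turns this frame into a frame for [MS4t], since the tense axioms hold for
    any relation and its converse and the converse of a preorder is a preorder.
    So if [MS4t] proves [sharp phi], then [sharp phi] holds throughout this
    frame under the canonical valuation ([MS4t_frame_sound]).  As [sharp phi]
    does not mention the past, [phi] then holds at every maximal consistent
    theory of [MS4], hence belongs to all of them ([truth_lemma]), hence is a
    theorem ([logic_of_worlds]). *)

(** * Kripke semantics *)

Section Semantics.

Context {M : Type}.

(** Truth at the point [x] of the frame with one relation [R m] for each
    modality [m], under the valuation [V]. *)
Fixpoint sat {W : Type} (R : M -> W -> W -> Prop) (V : nat -> W -> Prop)
    (x : W) (A : form M) : Prop :=
  match A with
  | Var n => V n x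
  | Bot => False
  | Neg B => ~ sat R V x B
  | And B C => sat R V x B /\ sat R V x C
  | Or B C => sat R V x B \/ sat R V x C
  | Imp B C => sat R V x B -> sat R V x C
  | Box m B => forall y, R m x y -> sat R V y B
  end.

(** Truth at every point under every valuation. *)
Definition valid {W : Type} (R : M -> W -> W -> Prop) (A : form M) : Prop :=
  forall V x, sat R V x A.

Lemma sat_subst {W : Type} (R : M -> W -> W -> Prop) V s A :
  forall x, sat R V x (subst s A) <-> sat R (fun n y => sat R V y (s n)) x A.
Proof.
induction A as [n| |A IHA|A IHA B IHB|A IHA B IHB|A IHA B IHB|m A IHA];
  intros x; simpl; try rewrite IHA; try rewrite IHB; try tauto.
split; intros H y Hy; apply IHA; auto.
Qed.

Definition bool_of (P : Prop) : bool :=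
  if excluded_middle_informative P then true else false.

Lemma bool_ofP P : bool_of P = true <-> P.
Proof.
unfold bool_of; destruct (excluded_middle_informative P); split; easy.
Qed.

(** Truth at a point is a two-valued truth in which boxed formulas are atoms; so
    tautologies hold at every point. *)
Lemma truth_sat {W : Type} (R : M -> W -> W -> Prop) V x A :
  truth (fun n => bool_of (V n x)) (fun m B => bool_of (sat R V x (Box m B))) A
    = true <-> sat R V x A.
Proof.
set (v := fun n => bool_of (V n x)).
set (w := fun m B => bool_of (sat R V x (Box m B))).
induction A as [n| |A IHA|A IHA B IHB|A IHA B IHB|A IHA B IHB|m A IHA];
  simpl; try exact (bool_ofP _); try easy;
  rewrite <- IHA; try rewrite <- IHB;
  repeat match goal with |- context [truth v w ?C] =>
    destruct (truth v w C) end; clear; simpl; intuition congruence.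
Qed.

(** A frame that validates the axioms validates the logic. *)
Lemma logic_sound {W : Type} (R : M -> W -> W -> Prop) (Ax : form M -> Prop) :
  (forall A, Ax A -> valid R A) -> forall A, logic Ax A -> valid R A.
Proof.
intros HAx A HA.
induction HA as [A HA|A HA|A B _ IHAB _ IHA|s A _ IH|m A _ IH]; intros V x.
- apply truth_sat, HA.
- now apply HAx.
- exact (IHAB V x (IHA V x)).
- apply sat_subst, IH.
- intros y _; apply IH.
Qed.

Context {W : Type} (R : M -> W -> W -> Prop).

Lemma S4_axiom_valid m :
  (forall x, R m x x) ->
  (forall x y z, R m x y -> R m y z -> R m x z) ->
  forall A, S4_axiom m A -> valid R A.
Proof.
intros Hrefl Htrans A [| |] V x; simpl; eauto.
Qed.

Lemma S5_axiom_valid m :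
  (forall x, R m x x) ->
  (forall x y, R m x y -> R m y x) ->
  (forall x y z, R m x y -> R m y z -> R m x z) ->
  forall A, S5_axiom m A -> valid R A.
Proof.
intros Hrefl Hsym Htrans A [B HB|].
- now apply (S4_axiom_valid m).
- intros V x; simpl; intros Hx y Hxy Hy; exact (Hy x (Hsym _ _ Hxy) Hx).
Qed.

Lemma tense_axiom_valid f b :
  (forall x y, R b x y <-> R f y x) ->
  forall A, tense_axiom f b A -> valid R A.
Proof.
intros Hconv A [|] V x; simpl; intros Hx y Hxy Hy; apply (Hy x); auto;
  now apply Hconv.
Qed.

Lemma mix_axiom_valid b a :
  (forall x y z, R a x y -> R b y z -> exists2 u, R b x u & R a u z) ->
  forall A, mix_axiom b a A -> valid R A.
Proof.
intros Hmix A [] V x; simpl; intros Hx y Hxy z Hyz.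
destruct (Hmix x y z Hxy Hyz) as [u Hxu Huz]; exact (Hx u Hxu z Huz).
Qed.

End Semantics.

(** * Maximal consistent theories *)

(** Proves that a formula is a tautology, by cases on the truth values of its
    propositional components. *)
Ltac taut :=
  intros v w; simpl;
  repeat match goal with |- context [truth ?v ?w ?C] =>
    destruct (truth v w C) end;
  repeat match goal with |- context [w ?m ?C] => destruct (w m C) end;
  reflexivity.

Section Canonical.

Context {M : Type} (Ax : form M -> Prop).

(** A theory is closed under modus ponens, but not under substitution or
    necessitation. *)
Record theory (T : form M -> Prop) : Prop := {
  theory_logic : forall A, logic Ax A -> T A;
  theory_mp : forall A B, T (A ~> B)%form -> T A -> T B }.

(** A maximal consistent theory: it omits [Bot] and decides every formula. *)
Record maximal (T : form M -> Prop) : Prop := {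
  maximal_theory : theory T;
  maximal_Bot : ~ T Bot;
  maximal_em : forall A, T A \/ T (Neg A) }.

Lemma logic_theory : theory (logic Ax).
Proof. split; [easy|exact (logic_mp Ax)]. Qed.

Lemma theory_taut1 T A B :
  theory T -> tautology (A ~> B)%form -> T A -> T B.
Proof.
intros HT HAB; apply (theory_mp T HT), (theory_logic T HT), logic_taut, HAB.
Qed.

Lemma theory_taut2 T A B C :
  theory T -> tautology (A ~> B ~> C)%form -> T A -> T B -> T C.
Proof.
intros HT HABC HA; apply (theory_mp T HT).
exact (theory_taut1 T _ _ HT HABC HA).
Qed.

(** The formulas that follow from [T] together with [A]. *)
Lemma theory_extend T A : theory T -> theory (fun B => T (A ~> B)%form).
Proof.
intros HT; split.
- intros B HB; apply (theory_taut1 T B); [easy|taut|].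
  now apply (theory_logic T HT).
- intros B C; apply (theory_taut2 T); [easy|taut].
Qed.

Lemma maximal_Neg T A : maximal T -> (T (Neg A) <-> ~ T A).
Proof.
intros HT; split.
- intros HnA HA; apply (maximal_Bot T HT).
  apply (theory_taut2 T A (Neg A)); [apply HT|taut|easy|easy].
- intros HnA; destruct (maximal_em T HT A); easy.
Qed.

Section Lindenbaum.

Context (code_M : M -> nat) (code_M_inj : forall m n, code_M m = code_M n -> m = n).

(** An injection of formulas into the natural numbers, built from an injection
    [code_M] of the modalities. *)
Fixpoint code (A : form M) : nat :=
  match A with
  | Var n => to_nat (0, n)
  | Bot => to_nat (1, 0)
  | Neg B => to_nat (2, code B)
  | And B C => to_nat (3, to_nat (code B, code C))
  | Or B C => to_nat (4, to_nat (code B, code C))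
  | Imp B C => to_nat (5, to_nat (code B, code C))
  | Box m B => to_nat (6, to_nat (code_M m, code B))
  end.

Lemma code_inj A B : code A = code B -> A = B.
Proof.
revert B; induction A; intros [] H; cbn [code] in H;
  apply to_nat_inj in H; try discriminate;
  apply pair_equal_spec in H as [_ H]; try reflexivity;
  try (apply to_nat_inj, pair_equal_spec in H as [? ?]);
  f_equal; auto.
Qed.

(** Stage [n] of the Lindenbaum construction extends the theory [T] so as to
    decide the formulas of code less than [n].  The formula of code [n], if there
    is one, is added at stage [S n] when its negation does not belong to stage
    [n]; the consequences of the addition are added with it, so that every stage
    is a theory. *)
Fixpoint stage (T : form M -> Prop) (n : nat) (B : form M) : Prop :=
  match n with
  | 0 => T B
  | S k => stage T k B \/
      exists A, code A = k /\ ~ stage T k (Neg A) /\ stage T k (A ~> B)%form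
  end.

Lemma stage_mono T n k B : n <= k -> stage T n B -> stage T k B.
Proof. induction 1; simpl; auto. Qed.

Lemma stage_theory T n : theory T -> theory (stage T n).
Proof.
intros HT; induction n as [|n IHn]; [exact HT|split; simpl].
- intros B HB; left; now apply (theory_logic _ IHn).
- intros B C HBC HB.
  assert (Hweak : forall A D, stage T n D -> stage T n (A ~> D)%form).
  { intros A D; apply (theory_taut1 _ _ _ IHn); taut. }
  destruct HBC as [HBC|[A [HA [HnA HBC]]]].
  + destruct HB as [HB|[A [HA [HnA HB]]]].
    * left; exact (theory_mp _ IHn B C HBC HB).
    * right; exists A; repeat split; auto.
      exact (theory_mp _ (theory_extend _ A IHn) B C (Hweak A _ HBC) HB).
  + right; exists A; repeat split; auto.
    apply (theory_mp _ (theory_extend _ A IHn) B C HBC).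
    destruct HB as [HB|[A' [HA' [_ HB]]]]; [now apply Hweak|].
    replace A with A'; [exact HB|apply code_inj; congruence].
Qed.

Lemma stage_consistent T n : theory T -> ~ T Bot -> ~ stage T n Bot.
Proof.
intros HT HBot; induction n as [|n IHn]; [exact HBot|].
intros [H|[A [_ [HnA H]]]]; [now apply IHn|apply HnA].
apply (theory_taut1 _ (A ~> Bot)%form); [now apply stage_theory|taut|exact H].
Qed.

Lemma lindenbaum T :
  theory T -> ~ T Bot -> exists2 x, maximal x & forall A, T A -> x A.
Proof.
intros HT HBot; exists (fun A => exists n, stage T n A).
2: intros A HA; now exists 0.
split; [split| |].
- intros A HA; exists 0; now apply (theory_logic T HT).
- intros A B [n Hn] [k Hk]; exists (Nat.max n k).
  apply (theory_mp _ (stage_theory T _ HT) A B).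
  + apply (stage_mono T n); [lia|exact Hn].
  + apply (stage_mono T k); [lia|exact Hk].
- intros [n Hn]; exact (stage_consistent T n HT HBot Hn).
- intros A; destruct (classic (stage T (code A) (Neg A))) as [H|H].
  + right; now exists (code A).
  + left; exists (S (code A)); right; exists A; repeat split; auto.
    apply (theory_logic _ (stage_theory T _ HT)), logic_taut; taut.
Qed.

(** A world is represented by the predicate of membership in a maximal
    consistent theory. *)
Definition world : Type := {x : form M -> Prop | maximal x}.

Definition holds (x : world) (A : form M) : Prop := proj1_sig x A.

Lemma holds_theory x : theory (holds x).
Proof. exact (maximal_theory _ (proj2_sig x)). Qed.

Lemma holds_logic x A : logic Ax A -> holds x A.
Proof. apply (theory_logic _ (holds_theory x)). Qed.

Lemma holds_mp x A B : holds x (A ~> B)%form -> holds x A -> holds x B.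
Proof. apply (theory_mp _ (holds_theory x)). Qed.

Lemma holds_Neg x A : holds x (Neg A) <-> ~ holds x A.
Proof. exact (maximal_Neg _ A (proj2_sig x)). Qed.

Lemma holds_Bot x : ~ holds x Bot.
Proof. exact (maximal_Bot _ (proj2_sig x)). Qed.

(** A formula outside a theory is refuted at a world that extends the theory. *)
Lemma theory_world T A :
  theory T -> ~ T A -> exists2 x : world, (forall B, T B -> holds x B) & ~ holds x A.
Proof.
intros HT HA.
destruct (lindenbaum (fun B => T (Neg A ~> B)%form)) as [x Hx HTx].
- now apply theory_extend.
- intros H; apply HA, (theory_taut1 T _ _ HT) with (2 := H); taut.
- exists (exist _ x Hx).
  + intros B HB; apply HTx, (theory_taut1 T B _ HT); [taut|exact HB].
  + apply holds_Neg, HTx, (theory_logic T HT), logic_taut; taut.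
Qed.

Lemma logic_of_worlds A : (forall x : world, holds x A) -> logic Ax A.
Proof.
intros H; apply NNPP; intros HA.
destruct (theory_world _ _ logic_theory HA) as [x _ Hx]; exact (Hx (H x)).
Qed.

(** * The canonical frame *)

(** The substitution of [A] and [B] for the variables [0] and [1], in which the
    axioms are written. *)
Definition inst (A B : form M) (n : nat) : form M :=
  match n with 0 => A | _ => B end.

(** The canonical relation of the modality [m]. *)
Definition canonical (m : M) (x y : world) : Prop :=
  forall A, holds x (Box m A) -> holds y A.

(** A variable is true at the worlds that contain it. *)
Definition canonical_val (n : nat) (x : world) : Prop := holds x (Var n).

(** The S4 axioms for [m] are among the axioms of the logic. *)
Definition has_S4 (m : M) : Prop := forall A, S4_axiom m A -> Ax A.

(** The S5 axioms for [m] are among the axioms of the logic. *)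
Definition has_S5 (m : M) : Prop := forall A, S5_axiom m A -> Ax A.

Lemma has_S5_S4 m : has_S5 m -> has_S4 m.
Proof. intros H A HA; apply H, S5_S4, HA. Qed.

Section Modality.

Context (m : M) (Hm : has_S4 m).

Lemma logic_K A B : logic Ax (Box m (A ~> B) ~> Box m A ~> Box m B)%form.
Proof.
exact (logic_subst Ax (inst A B) _ (logic_ax Ax _ (Hm _ (S4_K m)))).
Qed.

Lemma theory_unbox T : theory T -> theory (fun A => T (Box m A)).
Proof.
intros HT; split.
- intros A HA; now apply (theory_logic T HT), logic_nec.
- intros A B HAB; apply (theory_mp T HT).
  apply (theory_mp T HT) with (2 := HAB), (theory_logic T HT), logic_K.
Qed.

Lemma holds_Box x A : holds x (Box m A) <-> forall y, canonical m x y -> holds y A.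
Proof.
split; [intros H y Hxy; exact (Hxy A H)|intros H; apply NNPP; intros HA].
destruct (theory_world _ A (theory_unbox _ (holds_theory x)) HA) as [y Hxy Hy].
exact (Hy (H y Hxy)).
Qed.

Lemma canonical_refl x : canonical m x x.
Proof.
intros A; apply holds_mp, holds_logic.
exact (logic_subst Ax (inst A A) _ (logic_ax Ax _ (Hm _ (S4_T m)))).
Qed.

Lemma holds_BoxBox x A : holds x (Box m A) -> holds x (Box m (Box m A)).
Proof.
apply holds_mp, holds_logic.
exact (logic_subst Ax (inst A A) _ (logic_ax Ax _ (Hm _ (S4_4 m)))).
Qed.

Lemma canonical_trans x y z : canonical m x y -> canonical m y z -> canonical m x z.
Proof. intros Hxy Hyz A HA; apply Hyz, Hxy, holds_BoxBox, HA. Qed.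

End Modality.

Lemma canonical_sym m x y : has_S5 m -> canonical m x y -> canonical m y x.
Proof.
intros Hm Hxy A HA; apply NNPP; intros HnA.
assert (HB : holds x (Box m (Dia m (Neg A)))).
{ apply holds_mp with (Neg A); [apply holds_logic|now apply holds_Neg].
  exact (logic_subst Ax (inst (Neg A) A) _ (logic_ax Ax _ (Hm _ (S5_B m)))). }
apply Hxy in HB; apply holds_Neg in HB; apply HB.
apply holds_Box; [now apply has_S5_S4|intros z Hyz].
apply holds_Neg; rewrite holds_Neg; intros HnAz; exact (HnAz (Hyz A HA)).
Qed.

(** The axiom [mix_axiom b a] is canonical when [a] is an S5 modality. *)
Lemma canonical_mix b a x y z :
  has_S4 b -> has_S5 a -> (forall A, mix_axiom b a A -> Ax A) ->
  canonical a x y -> canonical b y z ->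
  exists2 u, canonical b x u & canonical a u z.
Proof.
intros Hb Ha Hmix Hxy Hyz.
pose proof (has_S5_S4 a Ha) as Ha4.
pose proof (theory_unbox b Hb _ (holds_theory x)) as Hx.
(* The consequences of the formulas [A] with [Box b A] in [x] and the formulas
   [Box a C] in [z]; one [C] is enough, as [Box a] commutes with
   conjunctions. *)
destruct (theory_world
  (fun B => exists2 C, holds z (Box a C) & holds x (Box b (Box a C ~> B)))
  Bot) as [u Hu _].
- split.
  + intros A HA; exists (Imp Bot Bot).
    * apply holds_logic, logic_nec, logic_taut; taut.
    * apply (theory_logic _ (theory_extend _ _ Hx)), HA.
  + intros A B [C HC HCA] [D HD HDB]; exists (And C D).
    * apply holds_Box; [exact Ha4|intros t Hzt].
      apply (theory_taut2 _ C D _ (holds_theory t)); [taut|now apply Hzt..].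
    * apply holds_Box; [exact Hb|intros t Hxt].
      apply Hxt in HCA; apply Hxt in HDB.
      apply (theory_taut1 _ (Imp (Box a (And C D)) B) _ (holds_theory t));
        [taut|].
      destruct (maximal_em _ (proj2_sig t) (Box a (And C D))) as [H|H].
      -- apply (theory_taut1 _ B _ (holds_theory t)); [taut|].
         apply (holds_mp t A).
         ++ apply (holds_mp t _ _ HCA), holds_Box; [exact Ha4|intros s Hts].
            apply (theory_taut1 _ (And C D) _ (holds_theory s)); [taut|].
            now apply Hts.
         ++ apply (holds_mp t _ _ HDB), holds_Box; [exact Ha4|intros s Hts].
            apply (theory_taut1 _ (And C D) _ (holds_theory s)); [taut|].
            now apply Hts.
      -- apply (theory_taut1 _ (Neg (Box a (And C D))) _ (holds_theory t));
           [taut|exact H].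
- intros [C HC HCx].
  (* As [a] is an S5 modality, [Neg (Box a C)] is equivalent to its own [a]-box;
     so the axiom carries it from the [b]-successors of [x] to [z]. *)
  assert (H : holds x (Box b (Box a (Neg (Box a C))))).
  { apply holds_Box; [exact Hb|intros t Hxt].
    apply holds_Box; [exact Ha4|intros s Hts].
    apply holds_Neg; intros HCs; apply (holds_Bot t).
    apply (holds_mp t _ _ (Hxt _ HCx)).
    apply (canonical_sym a t s Ha Hts), holds_BoxBox, HCs; exact Ha4. }
  apply holds_mp with (B := Box a (Box b (Neg (Box a C)))) in H.
  + apply Hxy in H; apply Hyz in H; apply holds_Neg in H; exact (H HC).
  + apply holds_logic.
    exact (logic_subst Ax (inst (Neg (Box a C)) Bot) _
             (logic_ax Ax _ (Hmix _ (mix b a)))).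
- exists u.
  + intros A HA; apply Hu; exists (Imp Bot Bot).
    * apply holds_logic, logic_nec, logic_taut; taut.
    * apply (theory_taut1 _ A _ Hx); [taut|exact HA].
  + apply canonical_sym; [exact Ha|].
    intros A HA; apply (canonical_refl a Ha4 u), Hu; exists A; [exact HA|].
    apply (theory_logic _ Hx), logic_taut; taut.
Qed.

Lemma truth_lemma A : (forall m, has_S4 m) ->
  forall x, sat canonical canonical_val x A <-> holds x A.
Proof.
intros Hnormal.
induction A as [n| |A IHA|A IHA B IHB|A IHA B IHB|A IHA B IHB|m A IHA];
  intros x; simpl; pose proof (holds_theory x) as Hx.
- reflexivity.
- split; [easy|apply holds_Bot].
- now rewrite IHA, holds_Neg.
- rewrite IHA, IHB; split.
  + intros [HA HB]; apply (theory_taut2 _ A B _ Hx); [taut|easy|easy].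
  + intros H; split; apply (theory_taut1 _ (And A B) _ Hx); easy || taut.
- rewrite IHA, IHB; split.
  + intros [H|H]; apply (theory_taut1 _ _ _ Hx) with (2 := H); taut.
  + intros H; destruct (classic (holds x A)) as [HA|HA]; [now left|right].
    apply holds_Neg in HA.
    apply (theory_taut2 _ (Or A B) (Neg A) _ Hx); [taut|easy|easy].
- rewrite IHA, IHB; split; [|apply holds_mp].
  intros H; destruct (classic (holds x A)) as [HA|HA].
  + apply (theory_taut1 _ B _ Hx); [taut|now apply H].
  + apply holds_Neg in HA; apply (theory_taut1 _ (Neg A) _ Hx); [taut|easy].
- rewrite holds_Box; [|apply Hnormal].
  split; intros H y Hy; apply IHA; now apply H.
Qed.

End Lindenbaum.

End Canonical.

(** * The translation *)

(** The action of [sharp] on modalities. *)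
Definition sharp_mod (m : modality_MS4) : modality_MS4t :=
  match m with Nec => Fut | All => AllT end.

Lemma sharp_Box m A : sharp (Box m A) = Box (sharp_mod m) (sharp A).
Proof. now destruct m. Qed.

Lemma sharp_subst s A : sharp (subst s A) = subst (fun n => sharp (s n)) (sharp A).
Proof. induction A as [| | | | | |[] A IHA]; simpl; congruence. Qed.

Lemma truth_sharp v w A :
  truth v w (sharp A) = truth v (fun m B => w (sharp_mod m) (sharp B)) A.
Proof. induction A as [| | | | | |[] A IHA]; simpl; congruence. Qed.

Lemma sharp_axiom A : MS4_axiom A -> MS4t_axiom (sharp A).
Proof.
intros [B HB|B HB|B HB].
- apply MS4t_Fut; destruct HB; constructor.
- apply MS4t_All; destruct HB as [B HB|]; [|exact (S5_B AllT)].
  apply S5_S4; destruct HB; constructor.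
- apply MS4t_mix; destruct HB; constructor.
Qed.

Lemma sharp_faithful A : MS4 A -> MS4t (sharp A).
Proof.
induction 1 as [A HA|A HA|A B _ IHAB _ IHA|s A _ IH|m A _ IH].
- apply logic_taut; intros v w; rewrite truth_sharp; apply HA.
- now apply logic_ax, sharp_axiom.
- exact (logic_mp _ _ _ IHAB IHA).
- rewrite sharp_subst; now apply logic_subst.
- rewrite sharp_Box; now apply logic_nec.
Qed.

(** The relations of a frame for [MS4t] obtained from those of a frame for
    [MS4]: the past relation is the converse of the future one. *)
Definition tense_rel {W : Type} (R : modality_MS4 -> W -> W -> Prop)
    (m : modality_MS4t) (x y : W) : Prop :=
  match m with
  | Fut => R Nec x y
  | Past => R Nec y x
  | AllT => R All x y
  end.

Lemma sat_sharp {W : Type} (R : modality_MS4 -> W -> W -> Prop) V A :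
  forall x, sat (tense_rel R) V x (sharp A) <-> sat R V x A.
Proof.
induction A as [n| |A IHA|A IHA B IHB|A IHA B IHB|A IHA B IHB|[] A IHA];
  intros x; simpl; try rewrite IHA; try rewrite IHB; try tauto;
  split; intros H y Hy; apply IHA; auto.
Qed.

(** The first five conditions make [R Nec] a preorder and [R All] an equivalence
    relation; the last one is what the mix axiom needs. *)
Lemma MS4t_frame_sound {W : Type} (R : modality_MS4 -> W -> W -> Prop) :
  (forall x, R Nec x x) ->
  (forall x y z, R Nec x y -> R Nec y z -> R Nec x z) ->
  (forall x, R All x x) ->
  (forall x y, R All x y -> R All y x) ->
  (forall x y z, R All x y -> R All y z -> R All x z) ->
  (forall x y z, R All x y -> R Nec y z -> exists2 u, R Nec x u & R All u z) ->
  forall A, MS4t A -> valid (tense_rel R) A.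
Proof.
intros Nrefl Ntrans Arefl Asym Atrans Hmix; apply logic_sound.
intros A [B HB|B HB|B HB|B HB|B HB].
- apply (S4_axiom_valid _ Fut); easy.
- apply (S4_axiom_valid _ Past); [easy| |easy].
  intros x y z Hxy Hyz; exact (Ntrans _ _ _ Hyz Hxy).
- now apply (tense_axiom_valid _ Fut Past).
- now apply (S5_axiom_valid _ AllT).
- now apply (mix_axiom_valid _ Fut AllT).
Qed.

Lemma sharp_full A : MS4t (sharp A) -> MS4 A.
Proof.
intros HA.
pose (c := fun m => match m with Nec => 0 | All => 1 end).
assert (c_inj : forall m n, c m = c n -> m = n) by now intros [] [].
assert (HN : has_S4 MS4_axiom Nec) by exact MS4_Nec.
assert (HF : has_S5 MS4_axiom All) by exact MS4_All.
assert (HF4 : has_S4 MS4_axiom All) by now apply has_S5_S4.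
apply (logic_of_worlds _ c c_inj); intros x.
apply (truth_lemma _ c c_inj); [now intros []|].
apply sat_sharp; revert HA; generalize (sharp A); intros B HB.
apply MS4t_frame_sound; [..|exact HB].
- now apply canonical_refl.
- now apply canonical_trans.
- now apply canonical_refl.
- intros y z; now apply (canonical_sym _ c c_inj).
- now apply canonical_trans.
- intros y z t; now apply (canonical_mix _ c c_inj); [..|exact MS4_mix].
Qed.

Theorem theorem4p12 (phi : form modality_MS4) : MS4 phi <-> MS4t (sharp phi).
Proof.
split; [apply sharp_faithful|apply sharp_full].
Qed.
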